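(* Let $\Sigma=(X,X_{fr},\widetilde B)$ be a seed, $I_0\subseteq X$, and let $\Sigma_{I_0,\emptyset}$ be the corresponding pure sub-seed, with cluster $X'=X\setminus I_0$. Then the pure cluster subalgebra $\mathcal A(\Sigma_{I_0,\emptyset})$ of $\mathcal A(\Sigma)$ is always a rooted cluster subalgebra of $\mathcal A(\Sigma)$.
   Context: **Seeds and cluster algebras.** A seed $\Sigma=(X,X_{fr},\widetilde B)$ consists of disjoint finite sets $X=\{x_1,\dots,x_n\}$ (the cluster; its elements are exchangeable variables; $X=\emptyset$ is allowed) and $X_{fr}=\{x_{n+1},\dots,x_{n+m}\}$ (frozen variables) such that the extended cluster $\widetilde X=X\cup X_{fr}$ is algebraically independent over $\mathbb Q$ and generates the field $\mathbb F(\Sigma)=\mathbb Q(\widetilde X)$, together with an integer matrix $\widetilde B=(b_{xy})_{x\in X,y\in\widetilde X}$ whose principal part $B=(b_{xy})_{x,y\in X}$ is totally sign-skew-symmetric: every matrix obtained from it by finitely many mutations is sign-skew-symmetric (for all $x,y$, either $b_{xy}=b_{yx}=0$ or $b_{xy}b_{yx}<0$). For $x\in X$ the mutation $\mu_x(\Sigma)$ replaces $x$ by $\mu_x(x)=x^{-1}\bigl(\prod_{b_{xt}>0}t^{b_{xt}}+\prod_{b_{xt}<0}t^{-b_{xt}}\bigr)$ ($t\in\widetilde X$), fixes the other variables ($\mu_x(y)=y$ for $y\ne x$), and replaces $\widetilde B$ by the matrix with entries $-b_{yz}$ if $y=x$ or $z=x$, and $b_{yz}+\frac{|b_{yx}|b_{xz}+b_{yx}|b_{xz}|}{2}$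 otherwise (relabelling $x$ as $\mu_x(x)$). $\mathcal A(\Sigma)$ is the $\mathbb Z[X_{fr}]$-subalgebra of $\mathbb F(\Sigma)$ generated by all cluster variables in all seeds obtained from $\Sigma$ by iterated mutations; together with its initial seed $\Sigma$ it is called a rooted cluster algebra. **Pure sub-seed.** For $I_0\subseteq X$, $\Sigma_{I_0,\emptyset}=(X\setminus I_0,X_{fr}\cup I_0,\widetilde B_0)$, with $\widetilde B_0$ the restriction of $\widetilde B$ to rows $X\setminus I_0$ and columns $\widetilde X$ (i.e. the variables in $I_0$ are frozen). $\mathcal A(\Sigma_{I_0,\emptyset})$ is called a pure cluster subalgebra of $\mathcal A(\Sigma)$. **Rooted cluster subalgebras.** A sequence $(y_1,\dots,y_l)$ is $\Sigma$-admissible if $y_1$ is exchangeable in $\Sigma$ and $y_i$ is exchangeable in $\mu_{y_{i-1}}\cdots\mu_{y_1}(\Sigma)$ for $i\ge2$; it is $(f,\Sigma,\Sigma')$-biadmissible if moreover $(f(y_1),\dots,f(y_l))$ is $\Sigma'$-admissible. A rooted cluster morphism $f:\mathcal A(\Sigma)\to\mathcal A(\Sigma')$ is a unital ring homomorphism with (CM1) $f(\widetilde X)\subseteq\widetilde X'\sqcup\mathbb Z$; (CM2) $f(X)\subseteq X'\sqcup\mathbb Z$; (CM3) $f(\mu_{y_s}\cdots\mu_{y_1}(y))=\mu_{f(y_s)}\cdots\mu_{f(y_1)}(f(y))$ for every $(f,\Sigma,\Sigma')$-biadmissible sequence $(y_1,\dots,y_s)$ and every $y\in\widetilde X$ (mutations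 fix integers). $\mathcal A(\Sigma')$ is a rooted cluster subalgebra of $\mathcal A(\Sigma)$ if there is an injective rooted cluster morphism $\mathcal A(\Sigma')\to\mathcal A(\Sigma)$. *)

(* Defs.v *)
From HB Require Import structures.
From mathcomp Require Import all_boot all_order all_algebra.
From mathcomp Require Import finmap boolp.
From mathcomp Require Import mpoly.

Set Implicit Arguments.
Unset Strict Implicit.
Unset Printing Implicit Defensive.

Import Order.TTheory GRing.Theory Num.Theory.
Local Open Scope fset_scope.
Local Open Scope ring_scope.

(* Variables are elements of the ambient field, so matrices are indexed by
   field elements. Matrices are total functions; only the entries (y, z) with
   y exchangeable and z in the extended cluster are meaningful. *)
Definition mutate_matrix (T : eqType) (B : T -> T -> int) (x : T) : T -> T -> int :=
  fun y z =>
    if (y == x) || (z == x) then - B y z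
    else B y z + ((`|B y x| * B x z + B y x * `|B x z|) %/ 2)%Z.

Definition sign_skew_symmetric (T : choiceType) (X : {fset T})
    (B : T -> T -> int) : Prop :=
  forall x y, x \in X -> y \in X ->
    (B x y = 0 /\ B y x = 0) \/ B x y * B y x < 0.

Definition totally_sign_skew_symmetric (T : choiceType) (X : {fset T})
    (B : T -> T -> int) : Prop :=
  forall s : seq T, {subset s <= X} ->
    sign_skew_symmetric X (foldl (@mutate_matrix T) B s).

(* On constants this says that [ratr] kills no nonzero rational, so F has
   characteristic 0 and [ratr] is the embedding of Q into F. *)
Definition algebraically_independent (F : fieldType) (s : seq F) : Prop :=
  forall p : {mpoly rat[size s]},
    mmap (@ratr F) (fun i : 'I_(size s) => s`_i) p = 0 -> p = 0.

Definition generates_field (F : fieldType) (s : seq F) : Prop :=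
  forall K : {pred F}, GRing.divring_closed K -> {subset s <= K} ->
    forall z : F, z \in K.

Record preseed (F : fieldType) := Preseed {
  cluster : {fset F};
  frozen : {fset F};
  exchange_matrix : F -> F -> int
}.

Definition extended_cluster (F : fieldType) (S : preseed F) : {fset F} :=
  cluster S `|` frozen S.

Record is_seed (F : fieldType) (S : preseed F) : Prop := IsSeed {
  seed_disjoint : [disjoint cluster S & frozen S]%fset;
  seed_algebraically_independent :
    algebraically_independent (extended_cluster S);
  seed_generates : generates_field (extended_cluster S);
  seed_sign_skew :
    totally_sign_skew_symmetric (cluster S) (exchange_matrix S)
}.

(* The ambient field F plays the role of Q(X, X_fr). *)
Record seed (F : fieldType) := Seed {
  preseed_of_seed :> preseed F;
  seedP : is_seed preseed_of_seed
}.

Section Mutation.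
Variable F : fieldType.
Implicit Types (S : preseed F) (x y z : F) (s : seq F).

Definition exchange_variable S x : F :=
  x^-1 * (\prod_(t <- extended_cluster S | 0 < exchange_matrix S x t)
              t ^ exchange_matrix S x t
        + \prod_(t <- extended_cluster S | exchange_matrix S x t < 0)
              t ^ (- exchange_matrix S x t)).

(* The action of mu_x on field elements; it fixes everything except x, in
   particular the integers. *)
Definition mutate_var S x y : F :=
  if y == x then exchange_variable S x else y.

Definition mutate S x : preseed F :=
  let x' := exchange_variable S x in
  let unlabel t := if t == x' then x else t in
  Preseed (x' |` (cluster S `\ x)) (frozen S)
    (fun y z => mutate_matrix (exchange_matrix S) x (unlabel y) (unlabel z)).

(* mu_{y_l} ... mu_{y_1}, for the sequence y_1, ..., y_l *)
Definition mutate_seq S s : preseed F := foldl mutate S s.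

Fixpoint mutate_var_seq S s y : F :=
  if s is x :: s' then mutate_var_seq (mutate S x) s' (mutate_var S x y) else y.

Fixpoint admissible S s : bool :=
  if s is x :: s' then (x \in cluster S) && admissible (mutate S x) s'
  else true.

Definition cluster_variable S z : Prop :=
  exists2 s, admissible S s & z \in cluster (mutate_seq S s).

(* A Z[X_fr]-subalgebra of F is the same thing as a subring of F containing
   X_fr. *)
Definition cluster_algebra_pred S : {pred F} := fun z =>
  `[< forall K : {pred F}, GRing.subring_closed K ->
        {subset frozen S <= K} ->
        (forall c, cluster_variable S c -> c \in K) ->
      z \in K >].

Lemma cluster_algebra_subring S : GRing.subring_closed (cluster_algebra_pred S).
Proof.
split=> [|u v /asboolP uA /asboolP vA|u v /asboolP uA /asboolP vA];
  apply/asboolP=> K ringK frK cvK; case: (ringK) => K1 KB KM.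
- by [].
- by apply: KB; [apply: uA | apply: vA].
- by apply: KM; [apply: uA | apply: vA].
Qed.

HB.instance Definition _ S :=
  GRing.isSubringClosed.Build F (cluster_algebra_pred S) (cluster_algebra_subring S).

Record cluster_algebra S := ClusterAlgebra {
  cluster_algebra_val :> F;
  _ : cluster_algebra_val \in cluster_algebra_pred S
}.

HB.instance Definition _ S := [isSub for @cluster_algebra_val S].
HB.instance Definition _ S := [Choice of cluster_algebra S by <:].
HB.instance Definition _ S :=
  [SubChoice_isSubComNzRing of cluster_algebra S by <:].

Lemma cluster_variable_in S z :
  cluster_variable S z -> z \in cluster_algebra_pred S.
Proof. by move=> Sz; apply/asboolP=> K _ _; apply. Qed.

Lemma frozen_in S z : z \in frozen S -> z \in cluster_algebra_pred S.
Proof. by move=> Sz; apply/asboolP=> K _ + _; apply. Qed.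

(* Iterated mutations of extended cluster variables stay in A(S). *)
Lemma mutate_var_seq_in S s y :
  admissible S s -> y \in extended_cluster S ->
  mutate_var_seq S s y \in cluster_algebra_pred S.
Proof.
move=> adm Sy.
have: mutate_var_seq S s y \in extended_cluster (mutate_seq S s).
  elim: s S y {adm} Sy => [|x s IHs] S y //= Sy.
  apply: IHs; rewrite /mutate_var; move: Sy.
  rewrite /extended_cluster !inE /=.
  case: (eqVneq y x) => [_|yx]; first by rewrite eqxx.
  by rewrite yx /= => /orP[]->; rewrite ?orbT.
rewrite /extended_cluster inE => /orP[clS|frS].
  by apply: cluster_variable_in; exists s.
apply: frozen_in; move: frS; congr (_ \in _).
by elim: s S {adm Sy} => //= x s IHs S; rewrite IHs.
Qed.

End Mutation.

Section Morphism.
Variables (F F' : fieldType) (S : seed F) (S' : seed F').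
Variable f : {rmorphism cluster_algebra S -> cluster_algebra S'}.

Definition biadmissible (s : seq (cluster_algebra S)) : bool :=
  admissible S (map val s) && admissible S' (map (fun y => val (f y)) s).

Definition CM1 : Prop :=
  forall y : cluster_algebra S, val y \in extended_cluster S ->
    val (f y) \in extended_cluster S' \/ exists k : int, f y = k%:~R.

Definition CM2 : Prop :=
  forall y : cluster_algebra S, val y \in cluster S ->
    val (f y) \in cluster S' \/ exists k : int, f y = k%:~R.

(* z is the mutated variable seen in A(S); it exists by [mutate_var_seq_in]. *)
Definition CM3 : Prop :=
  forall (s : seq (cluster_algebra S)) (y z : cluster_algebra S),
    biadmissible s -> val y \in extended_cluster S ->
    val z = mutate_var_seq S (map val s) (val y) ->
    val (f z) = mutate_var_seq S' (map (fun u => val (f u)) s) (val (f y)).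

Definition rooted_cluster_morphism : Prop := [/\ CM1, CM2 & CM3].

End Morphism.

Definition rooted_cluster_subalgebra (F' F : fieldType)
    (S' : seed F') (S : seed F) : Prop :=
  exists f : {rmorphism cluster_algebra S' -> cluster_algebra S},
    injective f /\ rooted_cluster_morphism f.

Section PureSubseed.
Variables (F : fieldType) (S : seed F) (I0 : {fset F}).

Definition pure_preseed : preseed F :=
  let X' := cluster S `\` I0 in
  Preseed X' (frozen S `|` I0)
    (fun y z => if (y \in X') && (z \in extended_cluster S)
                then exchange_matrix S y z else 0).

Hypothesis sI0 : I0 `<=` cluster S.

Lemma pure_extended_cluster :
  extended_cluster pure_preseed = extended_cluster S.
Proof.
apply/fsetP=> z; rewrite /extended_cluster !inE /=.
by have /implyP := fsubsetP sI0 z; case: (z \in I0); case: (z \in cluster S);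
  rewrite ?orbT ?orbF.
Qed.

Lemma mutate_matrix_eq_in (X : {fset F}) (B C : F -> F -> int) x :
  x \in X -> {in X &, B =2 C} ->
  {in X &, mutate_matrix B x =2 mutate_matrix C x}.
Proof. by move=> Xx BC y z Xy Xz; rewrite /mutate_matrix !BC. Qed.

Lemma pure_is_seed : is_seed pure_preseed.
Proof.
case: (seedP S) => dis alg gen skew; split; rewrite ?pure_extended_cluster //.
- apply/fdisjointP=> z /=; rewrite !inE => /andP[/negPf -> Xz]; rewrite orbF.
  exact: (fdisjointP dis).
- move=> s sX' x y X'x X'y.
  have sub z : z \in cluster pure_preseed -> z \in cluster S.
    by rewrite inE => /andP[].
  have eqB : {in cluster pure_preseed &, exchange_matrix S =2
                exchange_matrix pure_preseed}.
    move=> u v X'u X'v /=; move: (X'u) => /= ->.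
    by rewrite /extended_cluster inE sub.
  have eqBs : {in cluster pure_preseed &,
      foldl (@mutate_matrix F) (exchange_matrix S) s =2
      foldl (@mutate_matrix F) (exchange_matrix pure_preseed) s}.
    elim: s (exchange_matrix S) (exchange_matrix pure_preseed) sX' eqB
      => [|t s IHs] B C //= sX' BC; apply: IHs.
      by move=> u us; apply: sX'; rewrite inE us orbT.
    by apply: mutate_matrix_eq_in => //; apply: sX'; rewrite inE eqxx.
  rewrite -!eqBs //; apply: skew; [|exact: sub..].
  by move=> u /sX' /sub.
Qed.

Definition pure_subseed : seed F := Seed pure_is_seed.

End PureSubseed.

(* Main.v *)
(* The morphism is the inclusion. Freezing variables does not change the
   extended cluster, nor the rows of the exchange matrix that a mutation at a
   still exchangeable variable uses; so mutating the pure sub-seed and S along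
   the same sequence gives the same variables, provided that a new variable
   never coincides with another element of the extended cluster. This is
   ensured by propagating through the mutations derivations D_t of the ambient
   field with D_t u = [u = t] on the extended cluster: the new variable x'
   satisfies D_x x' <> 0, whereas D_x kills the other variables. *)

Require Import Defs.
From HB Require Import structures.
From mathcomp Require Import all_boot all_order all_algebra.
From mathcomp Require Import finmap boolp mpoly ring.

Set Implicit Arguments.
Unset Strict Implicit.
Unset Printing Implicit Defensive.

Import Order.TTheory GRing.Theory Num.Theory.
Local Open Scope fset_scope.
Local Open Scope ring_scope.

(** * Derivations and logarithmic derivatives *)

Definition derivation (A : pzRingType) (D : A -> A) : Prop :=
  {morph D : u v / u + v} /\ forall u v, D (u * v) = D u * v + u * D v.

Section Derivations.
Variables (A : pzRingType) (D : A -> A).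
Hypothesis derD : derivation D.

Let DD : {morph D : u v / u + v} := derD.1.
Let DM : forall u v, D (u * v) = D u * v + u * D v := derD.2.

Lemma derivation0 : D 0 = 0.
Proof. by apply: (addIr (D 0)); rewrite -DD !add0r. Qed.

Lemma derivation1 : D 1 = 0.
Proof.
by apply: (addIr (D 1)); rewrite add0r -{3}[1]mulr1 DM mulr1 mul1r.
Qed.

Lemma derivationN u : D (- u) = - D u.
Proof. by apply: (addIr (D u)); rewrite -DD !addNr derivation0. Qed.

End Derivations.

Section LogarithmicDerivative.
Variables (F : fieldType) (D : F -> F).
Hypothesis derD : derivation D.

Definition logder u : F := D u / u.

Lemma logder1 : logder 1 = 0.
Proof. by rewrite /logder derivation1 // mul0r. Qed.

Lemma logderM u v : u != 0 -> v != 0 ->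
  logder (u * v) = logder u + logder v.
Proof. by move=> u0 v0; rewrite /logder derD.2; field; rewrite u0 v0. Qed.

Lemma logderV u : u != 0 -> logder u^-1 = - logder u.
Proof.
move=> u0; apply: (addrI (logder u)).
by rewrite -logderM ?invr_eq0 // divff // logder1 subrr.
Qed.

Lemma logderX u (b : int) : u != 0 -> logder (u ^ b) = b%:~R * logder u.
Proof.
move=> u0; have logderXn n : logder (u ^+ n) = n%:R * logder u.
  elim: n => [|n IHn]; first by rewrite expr0 logder1 mul0r.
  by rewrite exprS logderM ?expf_neq0 // IHn -natr1; ring.
case: b => n; first exact: logderXn.
by rewrite NegzE -exprnN logderV ?expf_neq0 // logderXn mulrNz mulNr.
Qed.

Lemma logder_prod (I : Type) (r : seq I) (P : pred I) (g : I -> F) :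
  (forall i, g i != 0) ->
  logder (\prod_(i <- r | P i) g i) = \sum_(i <- r | P i) logder (g i).
Proof.
(* [logderM] asks for nonzero factors, so nonvanishing of the partial product is carried along with
   its logarithmic derivative. *)
move=> g0; pose K u v := u != 0 /\ logder u = v.
suff [] : K (\prod_(i <- r | P i) g i) (\sum_(i <- r | P i) logder (g i)) by [].
apply: big_rec2 => [|i v u _ [u0 uv]]; first by split; rewrite ?oner_neq0 ?logder1.
by split; rewrite ?mulf_neq0 // logderM // uv.
Qed.

End LogarithmicDerivative.

(** * Derivations dual to an algebraically independent generating set *)

(** Quotient rule on a chosen fraction for each [z]; [DE] shows that any other fraction gives the
    same value, so sums and products can be computed on convenient representatives. *)
Lemma fraction_derivation (A : comNzRingType) (F : fieldType)
    (phi : {rmorphism A -> F}) (d : A -> A) :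
  injective phi -> derivation d ->
  (forall z, exists ab : A * A, phi ab.2 != 0 /\ phi ab.1 = z * phi ab.2) ->
  exists2 D : F -> F, derivation D & forall a, D (phi a) = phi (d a).
Proof.
move=> phiI derd /choice[r rP]; have [dD dM] := derd.
pose D z := (phi (d (r z).1) - z * phi (d (r z).2)) / phi (r z).2.
have DE z a b : phi b != 0 -> phi a = z * phi b ->
    D z = (phi (d a) - z * phi (d b)) / phi b.
  move=> b0 az; rewrite /D; case: (r z) (rP z) => a' b' /= [b'0 az'].
  (* Two fractions of the same [z] satisfy this relation; applying [d] to it compares the two
     quotient rules. *)
  have /(congr1 (phi \o d)) /= : a * b' = a' * b.
    by apply: phiI; rewrite !rmorphM az az'; ring.
  rewrite !dM !rmorphD !rmorphM az az' => eqd.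
  apply/eqP; rewrite eqr_div //; apply/eqP.
  rewrite !mulrBl; apply/eqP; rewrite subr_eq addrAC; apply/eqP.
  have -> : phi (d a') * phi b = phi (d a) * phi b' + z * phi b * phi (d b')
      - z * phi b' * phi (d b) by rewrite eqd; ring.
  by ring.
exists D; last first.
  move=> a; rewrite (DE _ a 1) ?rmorph1 ?oner_neq0 ?mulr1 //.
  by rewrite (derivation1 derd) rmorph0 mulr0 subr0 divr1.
split=> [u v|u v]; have [bu au] := rP u; have [bv av] := rP v.
  rewrite (DE _ ((r u).1 * (r v).2 + (r v).1 * (r u).2) ((r u).2 * (r v).2)).
  - rewrite /D dD !dM !rmorphD !rmorphM au av; field.
    by rewrite bu bv.
  - by rewrite rmorphM mulf_neq0.
  - by rewrite rmorphD !rmorphM au av; ring.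
rewrite (DE _ ((r u).1 * (r v).1) ((r u).2 * (r v).2)).
- rewrite /D !dM !rmorphD !rmorphM au av; field.
  by rewrite bu bv.
- by rewrite rmorphM mulf_neq0.
- by rewrite !rmorphM au av; ring.
Qed.

(* Stands for algebraic independence of [E]: unlike independence itself, the
   existence of these "partial derivatives" is carried along a mutation by the
   chain rule. *)
Definition dual_derivations (F : fieldType) (E : {fset F}) (D : F -> F -> F) :=
  forall t, t \in E ->
    derivation (D t) /\ {in E, forall u, D t u = (u == t)%:R}.

Definition int_embeds (F : fieldType) : Prop :=
  forall k : int, k%:~R = 0 :> F -> k = 0.

(** Passes to integer coefficients, where evaluation is a ring morphism into any field; [ratr] is
    not one in positive characteristic. *)
Lemma algebraically_independent_int (F : fieldType) (s : seq F)
    (p : {mpoly int[size s]}) :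
  algebraically_independent s ->
  mmap intr (fun i : 'I_(size s) => s`_i) p = 0 -> p = 0.
Proof.
move=> ind p0; have intQI : injective (intr : int -> rat) by apply: intr_inj.
have /ind q0 : mmap (@ratr F) (fun i : 'I_(size s) => s`_i)
    (map_mpoly intr p) = 0.
  rewrite -[RHS]p0 /mmap (perm_big _ (msupp_map_mpoly p intQI)) /=.
  by apply: eq_bigr => m _; rewrite mcoeff_map_mpoly /= ratr_int.
apply/mpolyP=> m; apply: intQI.
by rewrite -mcoeff_map_mpoly q0 !mcoeff0.
Qed.

Lemma algebraically_independent_int_embeds (F : fieldType) (s : seq F) :
  algebraically_independent s -> int_embeds F.
Proof.
move=> ind k k0; have : k%:MP_[size s] = 0 :> {mpoly int[size s]}.
  by apply: (algebraically_independent_int ind); rewrite mmapC.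
by move/(congr1 (mcoeff 0%MM)); rewrite mcoeffC mcoeff0 eqxx mulr1.
Qed.

(** Independence embeds the polynomial ring in [F], and generation makes every element of [F] a
    fraction of its image, so the formal partial derivatives extend to [F]. *)
Lemma independent_dual_derivations (F : fieldType) (E : {fset F}) :
  algebraically_independent E -> generates_field E ->
  exists D, dual_derivations E D.
Proof.
move=> ind gen; pose n := size E.
pose phi : {rmorphism {mpoly int[n]} -> F} :=
  mmap intr (fun i : 'I_n => (E : seq F)`_i).
have phiI : injective phi.
  move=> p q pq; apply/eqP; rewrite -subr_eq0; apply/eqP.
  apply: (algebraically_independent_int ind).
  by rewrite mmapB; apply/eqP; rewrite subr_eq0; apply/eqP.
have phiX i : phi 'X_i = (E : seq F)`_i by rewrite /phi /= mmapX mmap1U.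
clearbody phi.
have frac z : exists ab : {mpoly int[n]} * {mpoly int[n]},
    phi ab.2 != 0 /\ phi ab.1 = z * phi ab.2.
  (* The fractions form a division-closed set containing [E], hence all of [F]. *)
  pose K : {pred F} := fun z => `[< exists ab : {mpoly int[n]} * {mpoly int[n]},
    phi ab.2 != 0 /\ phi ab.1 = z * phi ab.2 >].
  suff /asboolP : z \in K by [].
  apply: gen z => [|t tE]; last first.
    have tn : (index t E < n)%N by rewrite index_mem.
    apply/asboolP; exists ('X_(Ordinal tn), 1).
    by rewrite rmorph1 oner_neq0 phiX mulr1 /= nth_index.
  split=> [|u v /asboolP[[a b] /= [b0 au]] /asboolP[[c e] /= [e0 cv]]
           |u v /asboolP[[a b] /= [b0 au]] /asboolP[[c e] /= [e0 cv]]];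
    apply/asboolP.
  - by exists (1, 1); rewrite rmorph1 oner_neq0 mulr1.
  - exists (a * e - c * b, b * e); split=> /=; first by rewrite rmorphM mulf_neq0.
    by rewrite rmorphB !rmorphM au cv; ring.
  (* Since the inverse of 0 is 0, the quotient is then the fraction 0/1. *)
  have [v0|v0] := eqVneq v 0.
    by exists (0, 1); rewrite rmorph1 oner_neq0 rmorph0 v0 invr0 mulr0 mul0r.
  exists (a * e, b * c); split=> /=; first by rewrite rmorphM cv !mulf_neq0.
  by rewrite !rmorphM au cv; field.
have der i : exists D, derivation D /\ forall a, D (phi a) = phi a^`M(i).
  have [] := @fraction_derivation _ _ phi (mderiv i) phiI _ frac.
    by split; [exact: mderivD | exact: mderivM].
  by move=> D; exists D.
have {der} /choice[D DP] : forall t, exists D, t \in E ->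
    derivation D /\ {in E, forall u, D u = (u == t)%:R}.
  move=> t; case tE: (t \in E); last by exists id.
  have tn : (index t E < n)%N by rewrite index_mem.
  have [D [derD Dphi]] := der (Ordinal tn); exists D => _; split=> // u uE.
  have un : (index u E < n)%N by rewrite index_mem.
  have -> : u = phi 'X_(Ordinal un) by rewrite phiX nth_index.
  rewrite Dphi mderivX phiX nth_index //= mnm1E -val_eqE /=.
  have -> : (index u E == index t E) = (u == t).
    apply/eqP/eqP => [|->//] /(congr1 (nth 0 E)).
    by rewrite !nth_index.
  case: eqP => [ut|_]; last by rewrite scale0r rmorph0.
  have -> : Ordinal un = Ordinal tn by apply: val_inj; rewrite /= ut.
  have -> : (U_(Ordinal tn) - U_(Ordinal tn) = 0)%MM.
    by apply/mnmP=> j; rewrite mnmBE subnn mnm0E.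
  by rewrite mpolyX0 scale1r rmorph1.
by exists D.
Qed.

(** * Exchange binomials and a single exchange, seen by dual derivations *)

Section DualDerivations.
Variables (F : fieldType) (E : {fset F}) (D : F -> F -> F).
Hypothesis dualD : dual_derivations E D.

Lemma dual_neq0 t : t \in E -> t != 0.
Proof.
move=> tE; have [derD Dt] := dualD tE; apply/eqP=> t0.
by have /eqP := Dt t tE; rewrite eqxx {2}t0 derivation0 // eq_sym oner_eq0.
Qed.

Lemma monomial_neq0 (P : pred F) (e : F -> int) :
  \prod_(u <- E | P u) u ^ e u != 0.
Proof.
rewrite prodf_seq_neq0; apply/allP=> u /dual_neq0 u0.
by rewrite expfz_neq0 // implybT.
Qed.

Lemma logder_monomial t (P : pred F) (e : F -> int) : t \in E ->
  logder (D t) (\prod_(u <- E | P u) u ^ e u)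
  = if P t then (e t)%:~R / t else 0.
Proof.
move=> tE; have [derD Dt] := dualD tE.
transitivity
    (logder (D t) (\prod_(u <- E | P u) (if u \in E then u ^ e u else 1))).
  congr logder; rewrite big_seq_cond [RHS]big_seq_cond.
  by apply: eq_bigr => u /andP[->].
rewrite logder_prod // => [|u]; last first.
  by case: ifP; rewrite ?oner_neq0 // => /dual_neq0 u0; rewrite expfz_neq0.
rewrite big_mkcond (bigD1_seq t) //= big_seq_cond big1 ?addr0 => [|u].
  by rewrite tE logderX ?dual_neq0 // /logder Dt // eqxx mul1r.
case/andP=> uE /negPf ut; case: ifP => // _; rewrite uE logderX ?dual_neq0 //.
by rewrite /logder Dt // ut mul0r mulr0.
Qed.

Definition exchange_binomial (e : F -> int) : F :=
  \prod_(u <- E | 0 < e u) u ^ e u + \prod_(u <- E | e u < 0) u ^ (- e u).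

(** Both monomials have exponent 0 at [x], so their logarithmic derivatives vanish; being nonzero,
    they are killed by [D x]. *)
Lemma exchange_binomial_constant x e : x \in E -> e x = 0 ->
  D x (exchange_binomial e) = 0.
Proof.
move=> xE ex0; have [derD _] := dualD xE.
have := logder_monomial (fun u => 0 < e u) e xE.
have := logder_monomial (fun u => e u < 0) (fun u => - e u) xE.
rewrite ex0 ltxx /logder => /eqP; rewrite mulf_eq0 invr_eq0.
rewrite (negPf (monomial_neq0 _ _)) orbF => /eqP D2 /eqP; rewrite mulf_eq0 invr_eq0.
rewrite (negPf (monomial_neq0 _ _)) orbF => /eqP D1.
by rewrite /exchange_binomial derD.1 D1 D2 addr0.
Qed.

(* If the two monomials were opposite, they would have equal logarithmic
   derivatives, but those differ in the sign of the exponent. *)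
Lemma exchange_binomial_neq0 e : int_embeds F -> exchange_binomial e != 0.
Proof.
move=> intF; have [/hasP[t tE et0]|/hasPn e0] := boolP (has (fun u => e u != 0) E).
  have [derD _] := dualD tE.
  have L1 := logder_monomial (fun u => 0 < e u) e tE.
  have L2 := logder_monomial (fun u => e u < 0) (fun u => - e u) tE.
  apply: contra_neqN et0; rewrite /exchange_binomial addr_eq0 => /eqP M12.
  apply: intF; apply/eqP; move: L1; rewrite M12 /logder derivationN // invrN mulrNN.
  rewrite -/(logder _ _) L2; have t0 := dual_neq0 tE.
  (* Whatever the sign of [e t], one side of the equality is 0, which forces [e t] to vanish. *)
  case: ltgtP => [et|et|->]; rewrite ?mulr0z //.
    by move/eqP; rewrite mulf_eq0 invr_eq0 (negPf t0) orbF mulrNz oppr_eq0.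
  by move/esym/eqP; rewrite mulf_eq0 invr_eq0 (negPf t0) orbF.
(* With all exponents zero the binomial is 1 + 1, nonzero because the integers embed. *)
rewrite /exchange_binomial big_seq_cond [X in _ + X]big_seq_cond !big1 //.
- by apply/eqP=> /(intF 2%:Z).
- by move=> u /andP[/e0/negPn/eqP->]; rewrite ltxx.
- by move=> u /andP[/e0/negPn/eqP->]; rewrite ltxx.
Qed.

Section Exchange.
Variables (x M : F).
Hypotheses (xE : x \in E) (M0 : M != 0) (DM : D x M = 0).

Let x0 : x != 0 := dual_neq0 xE.

(** As [D x] kills [M], the logarithmic derivative is that of the inverse of [x], namely
    [- x^-1]. *)
Lemma exchange_derivative_neq0 : D x (x^-1 * M) != 0.
Proof.
have [derD Dx] := dualD xE.
have xM0 : x^-1 * M != 0 by rewrite mulf_neq0 ?invr_eq0.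
have : logder (D x) (x^-1 * M) = - x^-1.
  rewrite logderM ?invr_eq0 // logderV // /logder DM mul0r addr0.
  by rewrite Dx // eqxx mul1r.
by apply: contra_eq_neq => D0; rewrite /logder D0 mul0r eq_sym oppr_eq0 invr_eq0.
Qed.

Lemma exchange_notin : x^-1 * M \notin E `\ x.
Proof.
apply: contra exchange_derivative_neq0; rewrite !inE => /andP[yx yE].
by have [_ Dx] := dualD xE; rewrite Dx // (negPf yx).
Qed.

Lemma exchange_dual_derivations :
  exists D', dual_derivations ((x^-1 * M) |` (E `\ x)) D'.
Proof.
set y := x^-1 * M; have [derDx Dx] := dualD xE.
have c0 : D x y != 0 := exchange_derivative_neq0.
have yE : y \notin E `\ x := exchange_notin.
(* Change of coordinates from [x] to [y]: [D x] is rescaled to take the value 1 at [y], and each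
   other [D t] is corrected by the multiple of [D x] that makes it kill [y]. On [E] without [x] the
   correction vanishes. *)
exists (fun t u => if t == y then D x u / D x y
                   else D t u - D t y / D x y * D x u).
move=> t; rewrite in_fset1U; have [-> _|ty /= tE] := eqVneq t y.
  split=> [|u].
    split=> [u v|u v]; first by rewrite derDx.1 mulrDl.
    by rewrite derDx.2 mulrDl; ring.
  rewrite in_fset1U; have [-> _|uy /= uE] := eqVneq u y; first by rewrite divff.
  by move: uE; rewrite !inE => /andP[/negPf ux uE]; rewrite Dx // ux mul0r.
have /andP[tx tE'] : (t != x) && (t \in E) by move: tE; rewrite !inE.
have [derDt Dt] := dualD tE'.
split=> [|u].
  by split=> [u v|u v]; rewrite ?derDx.1 ?derDt.1 ?derDx.2 ?derDt.2; ring.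
rewrite in_fset1U; have [-> _|uy /= uE] := eqVneq u y.
  by rewrite divfK // subrr eq_sym (negPf ty).
move: uE; rewrite !inE => /andP[/negPf ux uE].
by rewrite (Dx u uE) ux mulr0 subr0 Dt.
Qed.

End Exchange.
End DualDerivations.

(** * Matrix entries under restriction and relabelling *)

Lemma exchange_variableE (F : fieldType) (S : preseed F) x :
  exchange_variable S x =
  x^-1 * exchange_binomial (extended_cluster S) (exchange_matrix S x).
Proof. by []. Qed.

Lemma sign_skew_diag (T : choiceType) (X : {fset T}) (B : T -> T -> int) x :
  sign_skew_symmetric X B -> x \in X -> B x x = 0.
Proof.
move=> skew xX; have [[]//|] := skew x x xX xX.
by rewrite ltNge -expr2 sqr_ge0.
Qed.

(** Matrix mutation inspects labels only through equality tests, which an injective relabelling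
    preserves. *)
Lemma relabel_mutations (T : choiceType) (X : {fset T}) (h : T -> T)
    (B : T -> T -> int) (s : seq T) :
  {in X &, injective h} -> {subset s <= X} ->
  {in X &, forall y z, foldl (@mutate_matrix T) (fun u v => B (h u) (h v)) s y z
     = foldl (@mutate_matrix T) B (map h s) (h y) (h z)}.
Proof.
move=> hI; elim/last_ind: s => [//|s x IHs] sX y z yX zX.
have xX : x \in X by apply: sX; rewrite mem_rcons inE eqxx.
have {}IHs : {in X &, forall y z,
    foldl (@mutate_matrix T) (fun u v => B (h u) (h v)) s y z
    = foldl (@mutate_matrix T) B (map h s) (h y) (h z)}.
  by apply: IHs => u us; apply: sX; rewrite mem_rcons inE us orbT.
by rewrite map_rcons !foldl_rcons /mutate_matrix !(inj_in_eq hI) // !IHs.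
Qed.

Lemma eq_exchange_binomial (F : fieldType) (E : {fset F}) (e e' : F -> int) :
  {in E, e =1 e'} -> exchange_binomial E e = exchange_binomial E e'.
Proof.
move=> ee'; congr (_ + _); rewrite big_seq_cond [RHS]big_seq_cond;
  apply: eq_big => [u|u /andP[uE _]];
  by [case uE: (u \in E); rewrite //= ee' | rewrite ee'].
Qed.

(** * Invariants preserved by mutation *)

Section MutationInvariant.
Variable F : fieldType.
Hypothesis intF : int_embeds F.
Implicit Types (S T : preseed F) (x : F).

Record regular S : Prop := Regular {
  regular_disjoint : [disjoint cluster S & frozen S]%fset;
  regular_skew : totally_sign_skew_symmetric (cluster S) (exchange_matrix S);
  regular_dual : exists D, dual_derivations (extended_cluster S) D
}.

Lemma cluster_extended S : {subset cluster S <= extended_cluster S}.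
Proof. by move=> x xS; rewrite inE xS. Qed.

Lemma extended_cluster_mutate S x :
  [disjoint cluster S & frozen S]%fset -> x \in cluster S ->
  extended_cluster (mutate S x) =
  exchange_variable S x |` (extended_cluster S `\ x).
Proof.
move=> /fdisjointP dis xS; apply/fsetP=> z.
rewrite /extended_cluster !inE /=.
by case: (eqVneq z x) => [->|_]; rewrite ?(negPf (dis _ xS)) /= -?orbA.
Qed.

Lemma regular_notin S x : regular S -> x \in cluster S ->
  exchange_variable S x \notin extended_cluster S `\ x.
Proof.
move=> [_ skew [D dualD]] xS; have xE := cluster_extended xS.
have Bxx : exchange_matrix S x x = 0.
  exact: sign_skew_diag (skew [::] _) xS.
apply: (exchange_notin dualD) => //.
  exact: exchange_binomial_neq0 dualD _ intF.
exact: exchange_binomial_constant.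
Qed.

Lemma regular_mutate S x : regular S -> x \in cluster S -> regular (mutate S x).
Proof.
move=> regS xS; have y_notin := regular_notin regS xS.
case: (regS) => [dis skew [D dualD]]; have xE := cluster_extended xS.
have Bxx : exchange_matrix S x x = 0.
  exact: sign_skew_diag (skew [::] _) xS.
have frx z : z \in frozen S -> z \in extended_cluster S `\ x.
  move=> zfr; rewrite !inE zfr orbT andbT.
  by apply: contraTneq zfr => ->; apply: (fdisjointP dis).
split.
- apply/fdisjointP=> z; rewrite /= !inE => /orP[/eqP->|/andP[_ zS]].
    by apply: contra y_notin => /frx.
  exact: (fdisjointP dis).
(* [u] restores the old labels. It is injective on the new cluster because [x] was removed there, so
   mutating the new matrix along [s] amounts to mutating the old one along [x :: map u s]. *)
- pose u t := if t == exchange_variable S x then x else t.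
  have uX : {in cluster (mutate S x), forall t, u t \in cluster S}.
    by move=> t; rewrite /u !inE; case: (t =P _) => //= _ /andP[].
  have uI : {in cluster (mutate S x) &, injective u}.
    move=> t v; rewrite /u !inE; case: (t =P _) => [->|_] /=;
      case: (v =P _) => [->|_] //=.
      by move=> _ /andP[/eqP vx _] /esym.
    by move=> /andP[/eqP tx _] _.
  move=> s sX t v tX vX.
  have sX' : {subset x :: map u s <= cluster S}.
    by move=> w; rewrite inE => /orP[/eqP->//|/mapP[w' /sX /uX uw ->]].
  have := skew _ sX' _ _ (uX _ tX) (uX _ vX).
  by rewrite /= -!(relabel_mutations _ uI sX).
- rewrite extended_cluster_mutate //; apply: (exchange_dual_derivations dualD) => //.
    exact: exchange_binomial_neq0 dualD _ intF.
  exact: exchange_binomial_constant.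
Qed.

(** The relation between a seed and its frozen version, kept along common mutations. Matrices are
    compared only on rows still exchangeable in [S], since frozen rows carry no information. *)
Record freezing S T : Prop := Freezing {
  freezing_source : regular S;
  freezing_target : regular T;
  freezing_cluster : {subset cluster S <= cluster T};
  freezing_extended : extended_cluster S = extended_cluster T;
  freezing_matrix : {in cluster S & extended_cluster S,
    exchange_matrix S =2 exchange_matrix T}
}.

Lemma freezing_exchange_variable S T x : freezing S T -> x \in cluster S ->
  exchange_variable S x = exchange_variable T x.
Proof.
move=> [_ _ _ ext eqB] xS; rewrite !exchange_variableE -ext; congr (_ * _).
by apply: eq_exchange_binomial => t; apply: eqB.
Qed.

(** A new entry in row [y] involves only old entries in rows [y] and [x], both exchangeable in [S];
    the equal exchange variables make the relabellings agree. *)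
Lemma freezing_mutate S T x : freezing S T -> x \in cluster S ->
  freezing (mutate S x) (mutate T x).
Proof.
move=> frST xS; have eqx := freezing_exchange_variable frST xS.
case: frST => regS regT sub ext eqB; have xT := sub x xS.
have eqE : extended_cluster (mutate S x) = extended_cluster (mutate T x).
  by rewrite !extended_cluster_mutate ?eqx ?ext //; apply: regular_disjoint.
split=> //; try exact: regular_mutate.
  move=> z; rewrite /= !inE eqx => /orP[->//|/andP[-> /sub ->]].
  by rewrite orbT.
move=> y z yX zX; rewrite /= -eqx.
set u := fun t => if t == exchange_variable S x then x else t.
rewrite -/(u y) -/(u z).
have uy : u y \in cluster S.
  by move: yX; rewrite /u !inE; case: eqP => //= _ /andP[].
have uz : u z \in extended_cluster S.
  move: zX; rewrite extended_cluster_mutate ?(regular_disjoint regS) //.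
  rewrite /u in_fset1U in_fsetD1; case: eqP => [_ _|_ /= /andP[]//].
  exact: cluster_extended.
by rewrite /mutate_matrix !eqB // cluster_extended.
Qed.

Lemma freezing_admissible S T s : freezing S T -> admissible S s ->
  admissible T s /\ freezing (mutate_seq S s) (mutate_seq T s).
Proof.
elim: s S T => [//|x s IHs] S T frST /= /andP[xS adm].
rewrite (freezing_cluster frST xS) /=.
exact: IHs (freezing_mutate frST xS) adm.
Qed.

Lemma freezing_mutate_var_seq S T s y : freezing S T -> admissible S s ->
  mutate_var_seq S s y = mutate_var_seq T s y.
Proof.
elim: s S T y => [//|x s IHs] S T y frST /= /andP[xS adm].
rewrite (IHs _ _ _ (freezing_mutate frST xS) adm) /mutate_var.
by rewrite (freezing_exchange_variable frST xS).
Qed.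

Lemma freezing_cluster_variable S T z : freezing S T ->
  cluster_variable S z -> cluster_variable T z.
Proof.
move=> frST [s /(freezing_admissible frST)[admT frs] zs].
by exists s => //; apply: freezing_cluster zs.
Qed.

Lemma freezing_cluster_algebra S T : freezing S T ->
  {subset cluster_algebra_pred S <= cluster_algebra_pred T}.
Proof.
move=> frST z /asboolP; apply; first exact: cluster_algebra_subring.
  move=> t tfr; have : t \in extended_cluster T.
    by rewrite -(freezing_extended frST) inE tfr orbT.
  (* A variable frozen in [S] may be exchangeable in [T]; it then lies in the initial cluster,
     reached by the empty sequence. *)
  rewrite inE => /orP[tT|]; last exact: frozen_in.
  by apply: cluster_variable_in; exists [::].
by move=> c /(freezing_cluster_variable frST)/cluster_variable_in.
Qed.

End MutationInvariant.

(** * The inclusion as a rooted cluster morphism *)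

Lemma seed_regular (F : fieldType) (S : seed F) : regular S.
Proof.
case: (seedP S) => dis ind gen skew; split=> //.
exact: independent_dual_derivations.
Qed.

Lemma seed_int_embeds (F : fieldType) (S : seed F) : int_embeds F.
Proof.
by case: (seedP S) => _ ind _ _; apply: algebraically_independent_int_embeds ind.
Qed.

Section Inclusion.
Variables (F : fieldType) (S T : preseed F).
Hypothesis sST : {subset cluster_algebra_pred S <= cluster_algebra_pred T}.

Definition cluster_algebra_incl (a : cluster_algebra S) : cluster_algebra T :=
  ClusterAlgebra (sST (valP a)).

Fact cluster_algebra_incl_is_zmod_morphism : zmod_morphism cluster_algebra_incl.
Proof. by move=> a b; apply: val_inj. Qed.

Fact cluster_algebra_incl_is_monoid_morphism :
  monoid_morphism cluster_algebra_incl.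
Proof. by split=> [|a b]; apply: val_inj. Qed.

HB.instance Definition _ :=
  GRing.isZmodMorphism.Build (cluster_algebra S) (cluster_algebra T)
    cluster_algebra_incl cluster_algebra_incl_is_zmod_morphism.
HB.instance Definition _ :=
  GRing.isMonoidMorphism.Build (cluster_algebra S) (cluster_algebra T)
    cluster_algebra_incl cluster_algebra_incl_is_monoid_morphism.

End Inclusion.

Lemma pure_freezing (F : fieldType) (S : seed F) (I0 : {fset F})
  (sI0 : I0 `<=` cluster S) : freezing (pure_subseed sI0) S.
Proof.
split; try exact: seed_regular.
- by move=> z; rewrite inE => /andP[].
- exact: pure_extended_cluster.
- by move=> y z yX; rewrite pure_extended_cluster //= => zX; rewrite yX zX.
Qed.

Theorem proposition4p3 (F : fieldType) (S : seed F) (I0 : {fset F})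
  (sI0 : I0 `<=` cluster S) :
  rooted_cluster_subalgebra (pure_subseed sI0) S.
Proof.
have frS := pure_freezing sI0; have intF := seed_int_embeds S.
have sub := freezing_cluster_algebra intF frS.
exists (cluster_algebra_incl sub); split.
  by move=> a b /(congr1 val) /= ab; apply: val_inj.
(* The inclusion keeps every variable in place, so the first two conditions hold by containment of
   clusters, and the third compares mutations along one and the same sequence. *)
split=> [y yE|y yX|s y z /andP[adm _] yE /= ->].
- by left; rewrite -(freezing_extended frS).
- by left; apply: freezing_cluster yX.
exact: freezing_mutate_var_seq.
Qed.
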